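(* Let $w\in B_\infty$ be a signed permutation that is not increasing, i.e. $w(1)<w(2)<\cdots$ fails. Let $(r<s)$ be the lexicographically largest pair of positive integers with $w(r)>w(s)$, put $v=wt_{rs}$, and let $$T(w)=\{\,w'=vt_{ir} : i<r,\ i\neq 0,\ \ell(w')=\ell(w)\,\}.$$ Then the Little bump $B^{-}_{(r,s)}$ is a bijection $$B^{-}_{(r,s)}:\ R(w)\longrightarrow \bigcup_{w'\in T(w)}R(w'),$$ realizing bijectively the identity $|R(w)|=\sum_{w'\in T(w)}|R(w')|$ given by the type C transition equation.
   Context: Signed permutations. $B_n$ is the group of bijections $w$ of $\{-n,\dots,-1,1,\dots,n\}$ with $w(-i)=-w(i)$; $B_n\subset B_{n+1}$ via $w(n+1)=n+1$, and $B_\infty=\bigcup_n B_n$, acting on $\mathbb{Z}\setminus\{0\}$. Products compose as functions: $(uv)(m)=u(v(m))$. For $i\ne j$ nonzero integers, $t_{ij}\in B_\infty$ interchanges $i$ with $j$ and $-i$ with $-j$ and fixes all other integers. Generators: $s_0=t_{-1,1}$ and $s_i=t_{i,i+1}$ for $i\ge1$. $\ell(w)$ is the minimal $p$ with $w=s_{a_1}\cdots s_{a_p}$; such a minimal $a=a_1\cdots a_p$ is a reduced word of $w$, and $R(w)$ is the set of reduced words of $w$. Wiring diagrams. For a word $b=b_1\cdots b_p$ of nonnegative integers, column $k$ ($1\le k\le p$) has crossings in rows $b_k$ and $-b_k$ (a single one if $b_k=0$). A crossing in row $r>0$ is between the wires at heights $r,r+1$; in row $0$ between heights $-1,1$; in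 row $r<0$ between heights $r-1,r$. Wires are labelled by their heights (in $\mathbb Z\setminus\{0\}$) at the right end, so the wire at height $m$ just to the right of column $k$ has label $(s_{b_p}\cdots s_{b_{k+1}})(m)$. If $a\in R(w)$ and $i<j$, wires $i$ and $j$ cross (exactly once) iff $w(i)>w(j)$. Little bump. Let $i<j$ be nonzero with $\ell(wt_{ij})=\ell(w)-1$ and let $\delta\in\{-,+\}$ be identified with $\varepsilon=-1$ or $+1$. For $a\in R(w)$, $B^{\delta}_{(i,j)}(a)$ is computed as follows. Start with $b=a$ and the active crossing $(k,r)$ = (column, row) where wires $i$ and $j$ cross in the diagram of $a$. (Push) Replace $b_k=|r|$ by $|r+\varepsilon|$, i.e. move the active crossing one row in direction $\varepsilon$ (and its mirror image oppositely). Let $x,y$ be the labels of the wires crossing in column $k$, row $r+\varepsilon$ of the new diagram. If $b$ is reduced, output $b$. Otherwise there is a unique $l\neq k$ such that deleting $b_l$ from $b$ leaves a reduced word, and wires $x$ and $y$ also cross in column $l$ in some row $r'\in\{b_l,-b_l\}$; make $(l,r')$ the new active crossing and repeat (Push) with the same $\varepsilon$. *)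

(* Defs.v *)
From mathcomp Require Import all_boot all_order all_algebra.
From mathcomp Require Export finmap.
From mathcomp Require Export boolp classical_sets functions cardinality fsbigop.

Set Implicit Arguments.
Unset Strict Implicit.
Unset Printing Implicit Defensive.

Import Order.TTheory GRing.Theory Num.Theory.
Local Open Scope classical_set_scope.
Local Open Scope ring_scope.

(* A signed permutation is represented by a function on all of int. Oddness
   forces w 0 = 0, so w restricts to a bijection of the nonzero integers, and
   w lies in B_n as soon as it fixes every m > n. *)
Definition Binf : set (int -> int) :=
  [set w | [/\ bijective w, (forall i, w (- i) = - w i)
             & exists n : int, forall m, n < m -> w m = m]].

(* Only meaningful for nonzero i, j; j = - i is allowed. *)
Definition t (i j m : int) : int :=
  if m == i then j else if m == j then i
  else if m == - i then - j else if m == - j then - i else m.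

Definition s (a : nat) : int -> int :=
  if a is 0%N then t (-1) 1 else t a%:Z (a%:Z + 1).

(* (s_{a_1} ... s_{a_p})(m) = s_{a_1}(...(s_{a_p}(m))) *)
Definition word_prod (a : seq nat) : int -> int := foldr (fun x w => s x \o w) id a.

(* The default 0 is only taken outside Binf, where no word has product w. *)
Definition ell (w : int -> int) : nat :=
  xget 0%N [set p : nat | (exists2 a, word_prod a = w & size a = p)
                     /\ (forall a, word_prod a = w -> (p <= size a)%N)].

Definition R (w : int -> int) : set (seq nat) :=
  [set a | word_prod a = w /\ size a = ell w].

Definition reduced (b : seq nat) : Prop := R (word_prod b) b.

(* Columns are numbered from 0, so that column k carries the letter nth 0 b k;
   the wire at height m just to the right of it has label
   (s_{b_{p-1}} ... s_{b_{k+1}})(m), whence the reversal. *)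
Definition label (b : seq nat) (k : nat) (m : int) : int :=
  word_prod (rev (drop k.+1 b)) m.

Definition row_heights (r : int) : int * int :=
  if 0 < r then (r, r + 1) else if r == 0 then (-1, 1) else (r - 1, r).

Definition cross (b : seq nat) (k : nat) (r x y : int) : Prop :=
  [/\ (k < size b)%N, r = (nth 0%N b k)%:Z \/ r = - (nth 0%N b k)%:Z
    & let h := row_heights r in
      (label b k h.1 = x /\ label b k h.2 = y)
      \/ (label b k h.1 = y /\ label b k h.2 = x)].

Definition push (e : int) (b : seq nat) (k : nat) (r : int) : seq nat :=
  set_nth 0%N b k `|(r + e)%R|%N.

Definition delete (b : seq nat) (l : nat) : seq nat := take l b ++ drop l.+1 b.

(* bump_run e b k r c: iterating (Push) in direction e from the word b with
   active crossing (k, r) terminates with output c. *)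
Inductive bump_run (e : int) : seq nat -> nat -> int -> seq nat -> Prop :=
| bump_stop (b : seq nat) (k : nat) (r : int) :
    reduced (push e b k r) -> bump_run e b k r (push e b k r)
| bump_next (b : seq nat) (k : nat) (r : int) (l : nat) (r' x y : int) (c : seq nat) :
    ~ reduced (push e b k r) ->
    cross (push e b k r) k (r + e) x y ->
    unique (fun l' : nat => [/\ l' <> k, (l' < size b)%N
                             & reduced (delete (push e b k r) l')]) l ->
    cross (push e b k r) l r' x y ->
    bump_run e (push e b k r) l r' c ->
    bump_run e b k r c.

(* The graph of B^delta_(i,j), with e = -1 or 1 for delta = - or +; a word a
   outside the domain of B^delta_(i,j) is related to nothing. *)
Definition bump_graph (e i j : int) (a b : seq nat) : Prop :=
  [/\ i <> 0, j <> 0 & i < j] /\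
  [/\ reduced a, (ell (word_prod a \o t i j)).+1 = ell (word_prod a)
    & exists k r, cross a k r i j /\ bump_run e a k r b].

Definition little_bump (e i j : int) (a : seq nat) : seq nat :=
  xget [::] [set b | bump_graph e i j a b].

Definition increasing (w : int -> int) : Prop := forall i : int, 0 < i -> w i < w (i + 1).

Definition inversion (w : int -> int) (r q : int) : Prop :=
  [/\ 0 < r, r < q & w r > w q].

Definition lex_largest_inversion (w : int -> int) (r q : int) : Prop :=
  inversion w r q /\
  forall r' q', inversion w r' q' -> r' < r \/ (r' = r /\ q' <= q).

Definition T (w : int -> int) (r q : int) : set (int -> int) :=
  let v := w \o t r q in
  [set w' | exists i : int,
     [/\ i < r, i <> 0, w' = v \o t i r & ell w' = ell w]].

(* Main.v *)
(** Removing the active column of any word met during the bump leaves a reduced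
    word of [v = w t_rs], and wire [r] is always one of the two wires crossing in
    that column: the lower one before a push by [-1], the upper one after it. If the
    pushed word is not reduced, exactly one other column can be removed instead, and
    there [r] is again the lower wire. Hence the bump is a walk along a relation that
    is both functional and injective. Along this walk the path of wire [r], drawn
    with the active column erased, moves strictly down, while its heights are bounded
    in terms of [r] and the length of the word; so the walk ends in both directions.
    Its starting points are the reduced words of covers [v t_ry] of [v] with [r < y],
    and by the choice of [(r, s)] only [y = s] occurs; its end points are the reduced
    words of the covers [v t_ir] with [i < r]. *)

Require Import Defs.
From mathcomp Require Import all_boot all_order all_algebra.
From mathcomp Require Import zify.
From Stdlib Require Import Relations.
Set Implicit Arguments.
Unset Strict Implicit.
Unset Printing Implicit Defensive.
Import Order.TTheory GRing.Theory Num.Theory.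
Local Open Scope classical_set_scope.
Local Open Scope ring_scope.

Local Notation "'P'" := word_prod.

(** * Products of words and wires *)

Definition lo (rho : int) : int := (row_heights rho).1.
Definition hi (rho : int) : int := (row_heights rho).2.
(** Rows stay signed: a column meets a row and its mirror image, and a push across row 0 is treated
    like any other. *)
Definition is_row (a : nat) (rho : int) : Prop := rho = a%:Z \/ rho = - a%:Z.

Ltac cases := repeat match goal with |- context [if ?b then _ else _] =>
  lazymatch b with context [if _ then _ else _] => fail | _ => case: (boolP b) => ? end end.

Lemma loE rho : lo rho = if 0 < rho then rho else rho - 1.
Proof. by rewrite /lo /row_heights; case: ifP => // _; case: eqP => [->|]. Qed.

Lemma hiE rho : hi rho = if 0 <= rho then rho + 1 else rho.
Proof. by rewrite /hi /row_heights; cases => /=; lia. Qed.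

Lemma t_odd i j m : i <> 0 -> j <> 0 -> t i j (- m) = - t i j m.
Proof. by move=> i0 j0; rewrite /t; cases; lia. Qed.

Lemma t_involutive i j : i <> 0 -> j <> 0 -> involutive (t i j).
Proof. move=> i0 j0 m; rewrite /t; cases; lia. Qed.

Lemma t_sym i j : i <> 0 -> j <> 0 -> t i j = t j i.
Proof. by move=> i0 j0; apply/funext => m; rewrite /t; cases; lia. Qed.

Lemma t_l i j : t i j i = j. Proof. by rewrite /t eqxx. Qed.

Lemma t_r i j : t i j j = i. Proof. by rewrite /t eqxx; case: eqP. Qed.

Lemma sE a rho : is_row a rho -> s a = t (lo rho) (hi rho).
Proof.
rewrite loE hiE /is_row => h; apply/funext => m.
case: a h => [|a] h /=; rewrite /t; cases; lia.
Qed.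

Lemma s_odd a m : s a (- m) = - s a m.
Proof. by case: a => [|a]; apply: t_odd; lia. Qed.

Lemma s_involutive a : involutive (s a).
Proof. by case: a => [|a]; apply: t_involutive; lia. Qed.

Lemma s_order a h h' : h <> 0 -> h' <> 0 -> h < h' -> s a h' < s a h ->
  exists rho, [/\ is_row a rho, h = lo rho & h' = hi rho].
Proof.
move=> h0 h'0 hh'; rewrite /is_row; case: a => [|a] /= H.
  exists 0; rewrite loE hiE; move: H; rewrite /t; cases; split; lia.
have [/= E|E] : h = a.+1 :> int \/ h <> a.+1 by lia.
  exists a.+1%:Z; rewrite loE hiE; move: H; rewrite /t; cases; split; lia.
exists (- a.+1%:Z); rewrite loE hiE; move: H; rewrite /t; cases; split; lia.
Qed.

Lemma prod_cat u v : P (u ++ v) = P u \o P v.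
Proof. by elim: u => //= a u ->. Qed.

Lemma prod_odd u m : P u (- m) = - P u m.
Proof. by elim: u => //= a u ->; rewrite s_odd. Qed.

Lemma prod_revK u : cancel (P u) (P (rev u)).
Proof.
elim: u => //= a u IH m.
by rewrite rev_cons -cats1 prod_cat /= s_involutive IH.
Qed.

Lemma prod_Krev u : cancel (P (rev u)) (P u).
Proof. by move=> m; rewrite -{1}(revK u) prod_revK. Qed.

Lemma prod_inj u : injective (P u).
Proof. exact: can_inj (prod_revK u). Qed.

Lemma prod0 u : P u 0 = 0.
Proof. by have := prod_odd u 0; rewrite oppr0; move: (P u 0) => x; lia. Qed.

Lemma prod_neq0 u m : m <> 0 -> P u m <> 0.
Proof. by move=> m0 /esym; rewrite -(prod0 u) => /prod_inj; lia. Qed.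

Lemma t_conj (f : int -> int) i j : injective f -> (forall m, f (- m) = - f m) ->
  f \o t i j = t (f i) (f j) \o f.
Proof.
move=> fI fN; apply/funext => m /=.
by rewrite /t -!fN !(inj_eq fI); repeat case: ifP.
Qed.

(** Conjugation by [P u2] turns the reflection in the heights [lo rho], [hi rho] into the reflection
    in the labels [x], [y]. *)
Lemma prod_crossing u1 a u2 rho x y : is_row a rho -> P u2 x = lo rho -> P u2 y = hi rho ->
  P (u1 ++ a :: u2) = P (u1 ++ u2) \o t x y.
Proof.
move=> ra hx hy; rewrite !prod_cat /= (sE ra) -hx -hy -compA.
by rewrite (@t_conj (P u2)) //; [apply: prod_inj | apply: prod_odd].
Qed.

Lemma prod_uncrossing u1 a u2 rho x y : is_row a rho -> P u2 x = lo rho -> P u2 y = hi rho ->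
  x <> 0 -> y <> 0 -> P (u1 ++ u2) = P (u1 ++ a :: u2) \o t x y.
Proof.
move=> ra hx hy x0 y0; rewrite (prod_crossing u1 ra hx hy).
by apply/funext => m /=; rewrite t_involutive.
Qed.

(** The two wires enter in one order and leave in the other, so some column switches them, and by
    [s_order] a letter switches two heights only by crossing them. *)
Lemma crossing_exists u x y : x <> 0 -> y <> 0 -> x < y -> P u y < P u x ->
  exists u1 a u2 rho, [/\ u = u1 ++ a :: u2, is_row a rho, P u2 x = lo rho & P u2 y = hi rho].
Proof.
move=> x0 y0 xy; elim: u => [|a u IH] /=; first by lia.
case: (ltP (P u y) (P u x)) => [/IH|].
  by case=> u1 [a'] [u2] [rho] [-> *]; exists (a :: u1), a', u2, rho.
rewrite le_eqVlt => /orP[/eqP/prod_inj|lt] H; first by lia.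
have [rho [*]] := s_order (prod_neq0 (u := u) x0) (prod_neq0 (u := u) y0) lt H.
by exists [::], a, u, rho.
Qed.

(** * Reduced words and crossings *)

Lemma ellP u : (exists2 c, P c = P u & size c = ell (P u))
  /\ (forall c, P c = P u -> (ell (P u) <= size c)%N).
Proof.
rewrite /ell; case: xgetP => [p _ //|h].
have ex : exists p, `[< exists2 c, P c = P u & size c = p >].
  by exists (size u); apply/asboolP; exists u.
have [p /asboolP hp hmin] := ex_minnP ex.
by case: (h p); split => // c hc; apply: hmin; apply/asboolP; exists c.
Qed.

Lemma reducedP b : reduced b <-> forall c, P c = P b -> (size b <= size c)%N.
Proof.
have [[c hc sc] hmin] := ellP b; split=> [[_ ->] //|h].
by split=> //; apply/eqP; rewrite eqn_leq hmin // -sc h.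
Qed.

Lemma equal_deletions u1 c u2 a u3 :
  P (u1 ++ c :: u2 ++ u3) = P (u1 ++ u2 ++ a :: u3) -> s c \o P u2 = P u2 \o s a.
Proof.
move=> H; apply/funext => m; have := congr1 (fun f => f (P (rev u3) m)) H.
rewrite !prod_cat /= !prod_cat /= => /prod_inj.
by rewrite !prod_Krev.
Qed.

(** The hypothesis says that the columns of [c] and [a] carry the same reflection, so together they
    cancel. *)
Lemma prod_double_deletion u1 c u2 a u3 : s c \o P u2 = P u2 \o s a ->
  P (u1 ++ c :: u2 ++ a :: u3) = P (u1 ++ u2 ++ u3).
Proof.
move=> H; apply/funext => m; have := congr1 (fun f => f (s a (P u3 m))) H.
by rewrite !prod_cat /= !prod_cat /= s_involutive => ->.
Qed.

Lemma double_deletion u1 c u2 a u3 :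
  s c \o P u2 = P u2 \o s a -> ~ reduced (u1 ++ c :: u2 ++ a :: u3).
Proof.
move=> H /reducedP /(_ (u1 ++ u2 ++ u3)).
rewrite (prod_double_deletion _ _ H) !size_cat /= !size_cat /= => /(_ erefl); lia.
Qed.

Lemma reduced_eq b c : reduced b -> P b = P c -> size c = size b -> reduced c.
Proof. by move=> /reducedP hb E sz; apply/reducedP => d; rewrite -E sz; apply: hb. Qed.

Lemma reduced_catl u v : reduced (u ++ v) -> reduced u.
Proof.
move=> /reducedP h; apply/reducedP => c hc; have := h (c ++ v).
by rewrite !prod_cat hc => /(_ erefl); rewrite !size_cat; lia.
Qed.

Lemma reduced_catr u v : reduced (u ++ v) -> reduced v.
Proof.
move=> /reducedP h; apply/reducedP => c hc; have := h (u ++ c).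
by rewrite !prod_cat hc => /(_ erefl); rewrite !size_cat; lia.
Qed.

Lemma lo_neq0 rho : lo rho <> 0. Proof. rewrite loE; cases; lia. Qed.
Lemma hi_neq0 rho : hi rho <> 0. Proof. rewrite hiE; cases; lia. Qed.
Lemma lo_lt_hi rho : lo rho < hi rho. Proof. rewrite loE hiE; cases; lia. Qed.
Lemma lo_inj : injective lo. Proof. move=> x y; rewrite !loE; cases; lia. Qed.
Lemma hi_inj : injective hi. Proof. move=> x y; rewrite !hiE; cases; lia. Qed.
Lemma hi_pred rho : hi (rho - 1) = lo rho. Proof. rewrite hiE loE; cases; lia. Qed.

Lemma label_neq0 u x m : P u x = m -> m <> 0 -> x <> 0.
Proof. by move=> <- h x0; apply: h; rewrite x0 prod0. Qed.

Lemma s_lo a rho : is_row a rho -> s a (lo rho) = hi rho.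
Proof. by move=> /sE ->; rewrite t_l. Qed.

Lemma s_hi a rho : is_row a rho -> s a (hi rho) = lo rho.
Proof. by move=> /sE ->; rewrite t_r. Qed.

(** Otherwise [u] has already crossed [x] and [y]; erasing that column together with [a] keeps the
    product and saves two letters. *)
Lemma reduced_cons_lt a u rho x y : reduced (a :: u) -> is_row a rho ->
  P u x = lo rho -> P u y = hi rho -> x < y.
Proof.
move=> /reducedP red ra hx hy; have := lo_lt_hi rho; rewrite -hx -hy => lt.
have x0 := label_neq0 hx (@lo_neq0 rho); have y0 := label_neq0 hy (@hi_neq0 rho).
case: (ltgtP x y) => // [yx|E]; last by move: lt; rewrite E ltxx.
have [v1 [c [v2 [rho' [E rc hy' hx']]]]] := crossing_exists y0 x0 yx lt.
have := red (v1 ++ v2); rewrite (prod_uncrossing _ rc hy' hx' y0 x0) -E.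
rewrite (t_sym y0 x0) (@prod_crossing [::] a u rho x y) // => /(_ erefl).
by rewrite E /= !size_cat /=; lia.
Qed.

Lemma reduced_rcons_lt u a rho : reduced (u ++ [:: a]) -> is_row a rho ->
  P u (lo rho) < P u (hi rho).
Proof.
move=> /reducedP red ra; have lt := lo_lt_hi rho.
case: (ltgtP (P u (lo rho)) (P u (hi rho))) => // [H|/prod_inj E]; last first.
  by move: lt; rewrite E ltxx.
have [v1 [c [v2 [rho' [E rc hx hy]]]]] :=
  crossing_exists (@lo_neq0 rho) (@hi_neq0 rho) lt H.
have := red (v1 ++ v2).
rewrite (prod_uncrossing _ rc hx hy (@lo_neq0 rho) (@hi_neq0 rho)) -E -(sE ra).
by rewrite prod_cat => /(_ erefl); rewrite E !size_cat /=; lia.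
Qed.

(** Two wires of a reduced word cross at most once: they keep their initial order up to the crossing
    and their final order after it. This tells which label is the lower one. *)
Lemma reduced_crossing u1 a u2 rho x y : reduced (u1 ++ a :: u2) -> is_row a rho ->
  P u2 x = lo rho -> P u2 y = hi rho ->
  x < y /\ P (u1 ++ a :: u2) y < P (u1 ++ a :: u2) x.
Proof.
move=> red ra hx hy; split.
  exact: reduced_cons_lt (reduced_catr red) ra hx hy.
rewrite prod_cat /= hx hy s_lo // s_hi //; apply: reduced_rcons_lt ra.
by apply: (@reduced_catl _ u2); rewrite -catA.
Qed.

(** The wires [x] and [y] must cross a second time, in the opposite sense: inside [u2] if [y < x],
    inside [u1] if [x < y] and [u1] exchanges them back. Both columns then carry the reflection
    [t x y], so erasing either gives the same product. *)
Lemma flip_exists u1 a u2 rho x y : reduced (u1 ++ u2) -> ~ reduced (u1 ++ a :: u2) ->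
  is_row a rho -> P u2 x = lo rho -> P u2 y = hi rho ->
  exists w1 c w2 rho', [/\ u1 ++ a :: u2 = w1 ++ c :: w2, size w1 <> size u1,
    P (w1 ++ w2) = P (u1 ++ u2) &
    [/\ is_row c rho', P w2 y = lo rho' & P w2 x = hi rho']].
Proof.
move=> red nred ra hx hy; have lt := lo_lt_hi rho.
have x0 := label_neq0 hx (@lo_neq0 rho); have y0 := label_neq0 hy (@hi_neq0 rho).
have main w1 c w2 rho' : u1 ++ a :: u2 = w1 ++ c :: w2 -> is_row c rho' ->
    P w2 y = lo rho' -> P w2 x = hi rho' -> P (w1 ++ w2) = P (u1 ++ u2).
  move=> E rc hy' hx'; rewrite (prod_uncrossing _ rc hy' hx' y0 x0) -E.
  by rewrite (t_sym y0 x0) -(prod_uncrossing _ ra hx hy x0 y0).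
case: (ltgtP x y) => [xy|yx|E]; last by move: lt; rewrite -hx -hy E ltxx.
  case: (ltgtP (P u1 (lo rho)) (P u1 (hi rho))) => [lt1|lt1|/prod_inj E]; last first.
  - by move: lt; rewrite E ltxx.
  - have [v1 [c [v2 [rho' [E rc hx' hy']]]]] :=
      crossing_exists (@lo_neq0 rho) (@hi_neq0 rho) lt lt1.
    exists v1, c, (v2 ++ a :: u2), rho'.
    have H1 : u1 ++ a :: u2 = v1 ++ c :: v2 ++ a :: u2 by rewrite E -catA.
    have hy2 : P (v2 ++ a :: u2) y = lo rho' by rewrite prod_cat /= hy s_hi.
    have hx2 : P (v2 ++ a :: u2) x = hi rho' by rewrite prod_cat /= hx s_lo.
    split => //; last exact: main H1 rc hy2 hx2.
    by rewrite E size_cat /=; lia.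
  (* In the remaining case every word [c] of the product inverts [x < y], hence loses a letter to
     become a word of [P (u1 ++ u2)]. So the word with [a] would be reduced. *)
  case: nred; apply/reducedP => c hc.
  have H : P c y < P c x by rewrite hc !prod_cat /= hx hy s_hi // s_lo.
  have [v1 [d [v2 [rho' [E rd hx' hy']]]]] := crossing_exists x0 y0 xy H.
  move/reducedP: red => /(_ (v1 ++ v2)).
  rewrite (prod_uncrossing _ rd hx' hy' x0 y0) -E hc.
  rewrite -(prod_uncrossing _ ra hx hy x0 y0) => /(_ erefl).
  by rewrite E !size_cat /=; lia.
have H : P u2 x < P u2 y by rewrite hx hy.
have [v1 [c [v2 [rho' [E rc hy' hx']]]]] := crossing_exists y0 x0 yx H.
exists (u1 ++ a :: v1), c, v2, rho'.
have H1 : u1 ++ a :: u2 = (u1 ++ a :: v1) ++ c :: v2 by rewrite E -catA.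
split => //; last exact: main H1 rc hy' hx'.
by rewrite size_cat /=; lia.
Qed.

(** * Deleting columns from a word *)

Lemma size_delete b k : (k < size b)%N -> size (delete b k) = (size b).-1.
Proof. by move=> h; rewrite /delete size_cat size_take size_drop h; lia. Qed.

Lemma delete_cat b u a v k : b = u ++ a :: v -> k = size u -> delete b k = u ++ v.
Proof.
move=> -> ->; rewrite /delete take_size_cat // -cat1s catA drop_size_cat //.
by rewrite size_cat addn1.
Qed.

Lemma split_word b k : (k < size b)%N ->
  b = take k b ++ nth 0%N b k :: drop k.+1 b.
Proof. by move=> h; rewrite -drop_nth // cat_take_drop. Qed.

Lemma split_word2 b k l : (k < l)%N -> (l < size b)%N ->
  exists (u : seq nat) c v a w, [/\ b = u ++ c :: v ++ a :: w, k = size u & l = size (u ++ c :: v)].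
Proof.
move=> kl lb; exists (take k b), (nth 0%N b k), (take (l - k.+1) (drop k.+1 b)), (nth 0%N b l),
  (drop l.+1 b).
have E : drop k.+1 b = take (l - k.+1) (drop k.+1 b) ++ nth 0%N b l :: drop l.+1 b.
  rewrite {1}(@split_word (drop k.+1 b) (l - k.+1)) ?size_drop; last by lia.
  rewrite nth_drop drop_drop.
  rewrite (_ : k.+1 + (l - k.+1) = l)%N; last by lia.
  by rewrite (_ : (l - k.+1).+1 + k.+1 = l.+1)%N //; lia.
have kb : (k < size b)%N by lia.
split; first by rewrite -E -split_word.
- by rewrite size_take kb.
- rewrite size_cat /= !size_take size_drop kb; case: ifP; lia.
Qed.

Lemma split_word3 b k l m : (k < l)%N -> (l < m)%N -> (m < size b)%N ->
  exists (u : seq nat) c v a w d z, [/\ b = u ++ c :: v ++ a :: w ++ d :: z, k = size u,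
    l = size (u ++ c :: v) & m = size (u ++ c :: v ++ a :: w)].
Proof.
move=> kl lm mb; have [u [c [v [a [w [E -> lE]]]]]] := split_word2 kl (ltn_trans lm mb).
have mw : (m - l.+1 < size w)%N by move: mb lE lm; rewrite E !size_cat /= size_cat /=; lia.
exists u, c, v, a, (take (m - l.+1) w), (nth 0%N w (m - l.+1)), (drop (m - l.+1).+1 w).
split => //; first by rewrite -split_word.
by move: lE lm; rewrite !size_cat /= size_cat /= size_take mw; lia.
Qed.

Lemma deletion_inj_lt b k l : reduced b -> (k < l)%N -> (l < size b)%N ->
  P (delete b k) <> P (delete b l).
Proof.
move=> red kl lb; have [u [c [v [a [w [E hk hl]]]]]] := split_word2 kl lb.
rewrite (delete_cat E hk) (@delete_cat _ (u ++ c :: v) a w) ?E -?catA // => H.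
by move: red; rewrite E; apply/double_deletion/(equal_deletions (esym H)).
Qed.

Lemma deletion_inj b k l : reduced b -> (k < size b)%N -> (l < size b)%N ->
  P (delete b k) = P (delete b l) -> k = l.
Proof.
move=> red kb lb H; case: (ltngtP k l) => // h.
  by case: (deletion_inj_lt red h lb).
by case: (deletion_inj_lt red h kb).
Qed.

(** This gives the uniqueness of the next column of the bump. If [m] lies outside the interval from
    [k] to [l], erasing it leaves two columns with the same reflection, and these cancel. The case
    of [m] between them needs a comparison of wires. *)
Lemma deletion_unique_lt b k l m : (k < l)%N -> (l < size b)%N -> (m < size b)%N ->
  P (delete b k) = P (delete b l) ->
  reduced (delete b k) -> reduced (delete b l) -> reduced (delete b m) ->
  m = k \/ m = l.
Proof.
move=> kl lb mb H redk redl redm.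
case: (ltngtP m k) => [mk|km|]; last by left.
  have [u [d [u1 [c [u2 [a [u3 [E hm hk hl]]]]]]]] := split_word3 mk kl lb.
  have Ek : delete b k = (u ++ d :: u1) ++ u2 ++ a :: u3.
    by apply: (@delete_cat _ _ c) => //; rewrite E -?catA /= -?catA.
  have El : delete b l = (u ++ d :: u1) ++ c :: u2 ++ u3.
    have -> : (u ++ d :: u1) ++ c :: u2 ++ u3 = (u ++ d :: u1 ++ c :: u2) ++ u3.
      by rewrite -?catA /= -?catA.
    by apply: (@delete_cat _ _ a) => //; rewrite E -?catA /= -?catA.
  have Em : delete b m = (u ++ u1) ++ c :: u2 ++ a :: u3.
    by rewrite -catA; apply: (@delete_cat _ _ d).
  rewrite Ek El in H; rewrite Em in redm.
  by case: (double_deletion (equal_deletions (esym H)) redm).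
case: (ltngtP m l) => [ml|lm|]; last by right.
  have [u1 [c [m1 [d [m2 [a [u3 [E hk hm hl]]]]]]]] := split_word3 km ml lb.
  have Ek : delete b k = u1 ++ (m1 ++ d :: m2) ++ a :: u3.
    by apply: (@delete_cat _ _ c) => //; rewrite E -?catA /= -?catA.
  have El : delete b l = u1 ++ c :: (m1 ++ d :: m2) ++ u3.
    have -> : u1 ++ c :: (m1 ++ d :: m2) ++ u3 = (u1 ++ c :: m1 ++ d :: m2) ++ u3.
      by rewrite -?catA /= -?catA.
    by apply: (@delete_cat _ _ a) => //; rewrite E -?catA /= -?catA.
  have Em : delete b m = (u1 ++ c :: m1) ++ m2 ++ a :: u3.
    by apply: (@delete_cat _ _ d) => //; rewrite E -?catA /= -?catA.
  have C : s c \o P (m1 ++ d :: m2) = P (m1 ++ d :: m2) \o s a.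
    by apply: (@equal_deletions u1 _ _ _ u3); rewrite -Ek -El.
  have Pb : P b = P (u1 ++ (m1 ++ d :: m2) ++ u3).
    by rewrite -(prod_double_deletion _ _ C) E -!catA.
  have rd : is_row d d by left.
  (* [d] lies between the two columns with equal reflections. Erasing column [k] keeps
     the wires [x], [y] of [d], erasing column [l] relabels them by the reflection; both
     words being reduced, [x < y] and [P b] inverts them, so erasing [d] shortens [P b]. *)
  set x := P (rev (m2 ++ a :: u3)) (lo d); set y := P (rev (m2 ++ a :: u3)) (hi d).
  have hx : P (m2 ++ a :: u3) x = lo d by rewrite prod_Krev.
  have hy : P (m2 ++ a :: u3) y = hi d by rewrite prod_Krev.
  have [|xy _] := @reduced_crossing (u1 ++ m1) d (m2 ++ a :: u3) d x y _ rd hx hy.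
    by move: redk; rewrite Ek -!catA.
  set x' := P (rev (m2 ++ u3)) (lo d); set y' := P (rev (m2 ++ u3)) (hi d).
  have hx' : P (m2 ++ u3) x' = lo d by rewrite prod_Krev.
  have hy' : P (m2 ++ u3) y' = hi d by rewrite prod_Krev.
  have [|_ lt] := @reduced_crossing (u1 ++ c :: m1) d (m2 ++ u3) d x' y' _ rd hx' hy'.
    by move: redl; rewrite El -?catA /= -?catA.
  have ltb : P b y < P b x.
    suff F z z' : P (m2 ++ a :: u3) z = P (m2 ++ u3) z' ->
        P b z = P ((u1 ++ c :: m1) ++ d :: m2 ++ u3) z'.
      by rewrite (F x x') ?(F y y') // ?hx ?hx' ?hy ?hy'.
    move=> hz; have -> : b = (u1 ++ c :: m1 ++ [:: d]) ++ m2 ++ a :: u3.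
      by rewrite E -?catA /= -?catA.
    have -> : (u1 ++ c :: m1) ++ d :: m2 ++ u3 = (u1 ++ c :: m1 ++ [:: d]) ++ m2 ++ u3.
      by rewrite -?catA /= -?catA.
    by rewrite prod_cat /= hz [in RHS]prod_cat.
  have x0 := label_neq0 hx (@lo_neq0 _); have y0 := label_neq0 hy (@hi_neq0 _).
  have {}ltb : P (u1 ++ (m1 ++ d :: m2) ++ u3) y < P (u1 ++ (m1 ++ d :: m2) ++ u3) x by rewrite -Pb.
  have [v1 [e [v2 [rho [F re ex ey]]]]] := crossing_exists x0 y0 xy ltb.
  move: redm => /reducedP /(_ (v1 ++ v2)).
  have -> : P (delete b m) = P (v1 ++ v2).
    rewrite (prod_uncrossing _ re ex ey x0 y0) -F -Pb Em.
    by rewrite (prod_uncrossing _ rd hx hy x0 y0) E -!catA.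
  move=> /(_ erefl); rewrite Em.
  have := congr1 size F; rewrite !size_cat /= ?size_cat /=; lia.
have [u1 [c [u2 [a [w1 [d [w2 [E hk hl hm]]]]]]]] := split_word3 kl lm mb.
have Em : delete b m = u1 ++ c :: u2 ++ a :: (w1 ++ w2).
  have -> : u1 ++ c :: u2 ++ a :: (w1 ++ w2) = (u1 ++ c :: u2 ++ a :: w1) ++ w2.
    by rewrite -?catA /= -?catA.
  by apply: (@delete_cat _ _ d) => //; rewrite E -?catA /= -?catA.
have Ek : delete b k = u1 ++ u2 ++ a :: (w1 ++ d :: w2) by apply: (@delete_cat _ _ c).
have El : delete b l = u1 ++ c :: u2 ++ (w1 ++ d :: w2).
  have -> : u1 ++ c :: u2 ++ (w1 ++ d :: w2) = (u1 ++ c :: u2) ++ w1 ++ d :: w2.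
    by rewrite -?catA /= -?catA.
  by apply: (@delete_cat _ _ a) => //; rewrite E -?catA /= -?catA.
rewrite Ek El in H; rewrite Em in redm.
by case: (double_deletion (equal_deletions (esym H)) redm).
Qed.

Lemma deletion_unique b k l m : k <> l -> (k < size b)%N -> (l < size b)%N -> (m < size b)%N ->
  P (delete b k) = P (delete b l) ->
  reduced (delete b k) -> reduced (delete b l) -> reduced (delete b m) ->
  m = k \/ m = l.
Proof.
move=> /eqP; rewrite neq_ltn => /orP[] kl kb lb mb H rk rl rm.
  exact: (deletion_unique_lt kl lb mb H).
by apply/or_comm; apply: (deletion_unique_lt kl kb mb (esym H)).
Qed.

(** A label is the preimage of a height under the word to the right, so crossings can be followed
    from their labels without reversing words. *)
Lemma crossP b k r x y : cross b k r x y <->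
  [/\ (k < size b)%N, is_row (nth 0%N b k) r &
    let d := drop k.+1 b in
    (P d x = lo r /\ P d y = hi r) \/ (P d y = lo r /\ P d x = hi r)].
Proof.
have E z m : (label b k m = z) = (P (drop k.+1 b) z = m).
  by apply/propext; rewrite /label; split => <-; rewrite ?prod_Krev ?prod_revK.
by rewrite /cross /= !E.
Qed.

Lemma cross_row_inj b k r r' x y : cross b k r x y -> cross b k r' x y -> r = r'.
Proof.
move=> /crossP[_ _ H] /crossP[_ _ H']; have := lo_lt_hi r; have := lo_lt_hi r'.
move=> lt lt'; apply: lo_inj; move: H H' lt lt' => /=.
by move: (P _ x) (P _ y) => p p'; lia.
Qed.

Lemma flip_exists_at b k rho x y : (k < size b)%N -> reduced (delete b k) -> ~ reduced b ->
  is_row (nth 0%N b k) rho -> P (drop k.+1 b) x = lo rho -> P (drop k.+1 b) y = hi rho ->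
  exists l rho', [/\ (l < size b)%N, l <> k, P (delete b l) = P (delete b k) &
    reduced (delete b l)] /\ [/\ is_row (nth 0%N b l) rho',
      P (drop l.+1 b) y = lo rho' & P (drop l.+1 b) x = hi rho'].
Proof.
move=> kb redk nred rk hx hy; have E := split_word kb.
have nred' : ~ reduced (take k b ++ nth 0%N b k :: drop k.+1 b) by rewrite -E.
have [w1 [c [w2 [rho' [F szw H [rc hy' hx']]]]]] :=
  @flip_exists (take k b) _ _ _ _ _ redk nred' rk hx hy.
exists (size w1), rho'; rewrite -E in F.
have lb : (size w1 < size b)%N by rewrite F size_cat /=; lia.
have D : delete b (size w1) = w1 ++ w2 by apply: delete_cat F _.
split; last by rewrite F nth_cat ltnn subnn -cat_rcons drop_size_cat // size_rcons.
split; rewrite ?D //; first by move=> h; apply: szw; rewrite size_take kb.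
by apply: reduced_eq redk (esym H) _; rewrite -D !size_delete.
Qed.

(** * Active crossings, pushes and flips *)

(* [active lo v i b k rho] (resp. [active hi]): removing column [k] of [b] leaves a
   reduced word of [v], and in row [rho] of that column wire [i] enters from the
   right at the lower (resp. upper) height. *)
Definition active (h : int -> int) (v : int -> int) (i : int) (b : seq nat) (k : nat) (rho : int) :=
  [/\ (k < size b)%N, is_row (nth 0%N b k) rho, reduced (delete b k), P (delete b k) = v
    & P (drop k.+1 b) i = h rho].

Lemma active_row_inj h v i b k rho rho' : injective h ->
  active h v i b k rho -> active h v i b k rho' -> rho = rho'.
Proof. by move=> hI [_ _ _ _ h1] [_ _ _ _ h2]; apply: hI; rewrite -h1. Qed.

Lemma active_reduced_inj h v i b k rho l rho' : injective h -> reduced b ->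
  active h v i b k rho -> active h v i b l rho' -> k = l /\ rho = rho'.
Proof.
move=> hI red A B; have E : k = l.
  by case: A B => kb _ _ <- _ [lb _ _ e _]; apply: (deletion_inj red).
by split => //; subst l; apply: active_row_inj hI A B.
Qed.

Lemma active_flip_inj h g v i b k rho l1 rho1 l2 rho2 : injective g ->
  active h v i b k rho -> active g v i b l1 rho1 -> active g v i b l2 rho2 ->
  l1 <> k -> l2 <> k -> l1 = l2 /\ rho1 = rho2.
Proof.
move=> gI A A1 A2 n1 n2; suff E : l2 = l1.
  by split => //; subst l2; apply: active_row_inj gI A1 A2.
case: A A1 A2 => kb _ rk Pk _ [l1b _ r1 P1 _] [l2b _ r2 P2 _].
by case: (@deletion_unique b k l1 l2) => //; [exact/nesym | rewrite P1].
Qed.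

(** The second crossing of the same two wires has the opposite sense, so [i], upper after the push,
    is lower there and ready for the next push. *)
Lemma flip_down v i b k rho : active hi v i b k rho -> ~ reduced b ->
  exists l rho' z, [/\ active lo v i b l rho', l <> k, cross b k rho z i &
    cross b l rho' z i].
Proof.
move=> [kb rk redk Pk hi_i] nred; set z := P (rev (drop k.+1 b)) (lo rho).
have hz : P (drop k.+1 b) z = lo rho by rewrite prod_Krev.
have [l [rho' [[lb lk Pl redl] [rl lo_i hi_z]]]] := flip_exists_at kb redk nred rk hz hi_i.
exists l, rho', z; split => //; first by split=> //; rewrite Pl.
  by apply/crossP; split => //; left.
by apply/crossP; split => //; right.
Qed.

Lemma flip_up v i b k rho : active lo v i b k rho -> ~ reduced b ->
  exists l rho', active hi v i b l rho' /\ l <> k.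
Proof.
move=> [kb rk redk Pk lo_i] nred; set z := P (rev (drop k.+1 b)) (hi rho).
have hz : P (drop k.+1 b) z = hi rho by rewrite prod_Krev.
have [l [rho' [[lb lk Pl redl] [rl lo_z hi_i]]]] := flip_exists_at kb redk nred rk lo_i hz.
by exists l, rho'; split => //; split=> //; rewrite Pl.
Qed.

Lemma size_push e b k r : (k < size b)%N -> size (push e b k r) = size b.
Proof. by move=> kb; rewrite /push size_set_nth; apply/maxn_idPr. Qed.

Lemma push_cat e b k r : (k < size b)%N ->
  push e b k r = take k b ++ `|(r + e)%R|%N :: drop k.+1 b.
Proof. by move=> kb; rewrite /push set_nthE kb. Qed.

Lemma take_push e b k r : (k < size b)%N -> take k (push e b k r) = take k b.
Proof. by move=> kb; rewrite push_cat // take_size_cat // size_take kb. Qed.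

Lemma drop_push e b k r : (k < size b)%N -> drop k.+1 (push e b k r) = drop k.+1 b.
Proof.
by move=> kb; rewrite push_cat // -cat_rcons drop_size_cat // size_rcons size_take kb.
Qed.

Lemma delete_push e b k r : (k < size b)%N -> delete (push e b k r) k = delete b k.
Proof. by move=> kb; rewrite /delete take_push // drop_push. Qed.

Lemma nth_push e b k r : nth 0%N (push e b k r) k = `|(r + e)%R|%N.
Proof. by rewrite /push nth_set_nth /= eqxx. Qed.

(** A push overwrites the letter, so a second push in the same column restores [b] once it aims at a
    row of the old letter. *)
Lemma push_push e f b k r r' : (k < size b)%N -> is_row (nth 0%N b k) (r' + f) ->
  push f (push e b k r) k r' = b.
Proof.
move=> kb rk; rewrite push_cat ?size_push // take_push // drop_push //.
rewrite [RHS](split_word kb); congr (_ ++ _ :: _); case: rk => ->; lia.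
Qed.

Lemma is_row_abs r : is_row `|r|%N r. Proof. rewrite /is_row; lia. Qed.

(** Adjacent rows share a height, [hi (rho - 1) = lo rho]: the wire [i] does not move, but becomes
    the upper one of its crossing. *)
Lemma push_down v i b k rho : active lo v i b k rho ->
  active hi v i (push (-1) b k rho) k (rho - 1).
Proof.
move=> [kb rk redk Pk lo_i]; split; rewrite ?size_push ?delete_push ?drop_push ?hi_pred //.
by rewrite nth_push; apply: is_row_abs.
Qed.

Lemma push_up v i b k rho : active hi v i b k rho ->
  active lo v i (push 1 b k rho) k (rho + 1).
Proof.
move=> [kb rk redk Pk hi_i]; split; rewrite ?size_push ?delete_push ?drop_push //.
  by rewrite nth_push; apply: is_row_abs.
by rewrite -hi_pred addrK.
Qed.

(** * The potential of a wire *)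

Fixpoint height_sum (u : seq nat) (m : int) : int :=
  if u is _ :: u' then P u m + height_sum u' m else 0.

(* The heights of wire [i] summed over the gaps between columns, column [k] being erased. *)
Definition potential (i : int) (b : seq nat) (k : nat) : int :=
  let m := P (drop k.+1 b) i in height_sum (take k b) m + m + height_sum (drop k.+1 b) i.

Lemma height_sum_cat u v m : height_sum (u ++ v) m = height_sum u (P v m) + height_sum v m.
Proof. by elim: u => [|a u IH] /=; rewrite ?add0r // IH prod_cat addrA. Qed.

Lemma nth_size_cat (b u : seq nat) a v k : b = u ++ a :: v -> k = size u -> nth 0%N b k = a.
Proof. by move=> -> ->; rewrite nth_cat ltnn subnn. Qed.

Lemma drop_size_cat1 (b u : seq nat) a v k : b = u ++ a :: v -> k = size u -> drop k.+1 b = v.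
Proof. by move=> -> ->; rewrite -cat_rcons drop_size_cat // size_rcons. Qed.

Lemma potential_cat i b u a v k : b = u ++ a :: v -> k = size u ->
  potential i b k = height_sum u (P v i) + P v i + height_sum v i.
Proof.
by move=> E hk; rewrite /potential (drop_size_cat1 E hk) E hk take_size_cat.
Qed.

(** The letter [a] already crosses the two wires, so no suffix of [u] may cross them again: the
    comparison holds gap by gap. *)
Lemma height_sum_le u a rho : reduced (u ++ [:: a]) -> is_row a rho ->
  height_sum u (lo rho) <= height_sum u (hi rho).
Proof.
move=> + ra; elim: u => //= b u IH red; apply: lerD.
  exact/ltW/(@reduced_rcons_lt (b :: u) a).
exact/IH/(@reduced_catr [:: b]).
Qed.

(* Wire [i] changes its path only between the two columns, where it passes from the
   trajectory of the upper height of a crossing to that of the lower height. *)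
Lemma potential_flip v i b k rho l rho' : active hi v i b k rho -> active lo v i b l rho' ->
  l <> k -> potential i b l < potential i b k.
Proof.
move=> [kb rk redk Pk hi_i] [lb rl redl Pl lo_i] lk.
case: (ltngtP k l) => [kl|{}lk|/esym //].
  have [u1 [c [u2 [a [u3 [E hk hl]]]]]] := split_word2 kl lb.
  have E' : b = (u1 ++ c :: u2) ++ a :: u3 by rewrite E -catA.
  have dk : delete b k = u1 ++ u2 ++ a :: u3 := delete_cat E hk.
  have dl : delete b l = u1 ++ c :: u2 ++ u3 by rewrite (delete_cat E' hl) -catA.
  have C : s c \o P u2 = P u2 \o s a.
    by apply: (@equal_deletions u1 _ _ _ u3); rewrite -dk -dl Pk.
  move: rl lo_i; rewrite (nth_size_cat E' hl) (drop_size_cat1 E' hl) => rl lo_i.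
  rewrite (potential_cat _ E' hl) (potential_cat _ E hk) !height_sum_cat /= ?height_sum_cat /=.
  (* By [C] both paths of [i] enter [u1] at the same height, so they differ only along [u2] and at
     its right end. *)
  rewrite prod_cat /= lo_i s_lo //; have /= := congr1 (fun f => f (lo rho')) C.
  rewrite s_lo // => ->.
  have := lo_lt_hi rho'; have : height_sum u2 (lo rho') <= height_sum u2 (hi rho').
    apply: height_sum_le rl; apply: (@reduced_catr u1); apply: (@reduced_catl _ u3).
    by move: redk; rewrite dk -!catA.
  by move: (height_sum u2 _) (height_sum u2 _); lia.
have [u1 [c [u2 [a [u3 [E hl hk]]]]]] := split_word2 lk kb.
have E' : b = (u1 ++ c :: u2) ++ a :: u3 by rewrite E -catA.
have dl : delete b l = u1 ++ u2 ++ a :: u3 := delete_cat E hl.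
have dk : delete b k = u1 ++ c :: u2 ++ u3 by rewrite (delete_cat E' hk) -catA.
have C : s c \o P u2 = P u2 \o s a.
  by apply: (@equal_deletions u1 _ _ _ u3); rewrite -dk -dl Pk.
move: rk hi_i; rewrite (nth_size_cat E' hk) (drop_size_cat1 E' hk) => rk hi_i.
rewrite (potential_cat _ E' hk) (potential_cat _ E hl) !height_sum_cat /= ?height_sum_cat /=.
rewrite prod_cat /= hi_i s_hi //; have /= := congr1 (fun f => f (hi rho)) C.
rewrite s_hi // => ->.
have := lo_lt_hi rho; have : height_sum u2 (lo rho) <= height_sum u2 (hi rho).
  apply: height_sum_le rk; apply: (@reduced_catr u1); apply: (@reduced_catl _ u3).
  by move: redl; rewrite dl -!catA.
by move: (height_sum u2 _) (height_sum u2 _); lia.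
Qed.

Lemma potential_push e i b k r : (k < size b)%N -> potential i (push e b k r) k = potential i b k.
Proof. by move=> kb; rewrite /potential take_push // drop_push. Qed.

Lemma s_abs_le a m : `|s a m| <= `|m| + 1.
Proof. by case: a => [|a] /=; rewrite /t; cases; lia. Qed.

Lemma prod_abs_le u m : `|P u m| <= `|m| + (size u)%:Z.
Proof. by elim: u => [|a u IH] /=; [|have := s_abs_le a (P u m)]; lia. Qed.

Lemma height_sum_abs_le u m K : `|m| + (size u)%:Z <= K -> `|height_sum u m| <= (size u)%:Z * K.
Proof.
elim: u => [|a u IH] /= H; first by rewrite mul0r.
have := IH ltac:(lia); have := prod_abs_le (a :: u) m => /= h1 h2.
have -> : (size u).+1%:Z * K = K + (size u)%:Z * K by rewrite -addn1 PoszD mulrDl mul1r addrC.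
by apply: le_trans (ler_normD _ _) _; apply: lerD => //; apply: le_trans H.
Qed.

(** With column [k] erased there are [size b] gaps, and a wire moves by at most one plus the jump
    over 0 counted in [s_abs_le], so each height is at most [|i| + size b]. *)
Lemma potential_abs_le i b k : (k < size b)%N ->
  `|potential i b k| <= (size b)%:Z * (`|i| + (size b)%:Z).
Proof.
move=> kb; rewrite /potential; set d := drop _ _; set K := `|i| + _.
have sd : (size d = size b - k.+1)%N by rewrite size_drop.
have st : (size (take k b) = k)%N by rewrite size_take kb.
have hd := prod_abs_le d i.
have h1 : `|height_sum (take k b) (P d i)| <= k%:Z * K.
  by rewrite -[k in k%:Z]st; apply: height_sum_abs_le; rewrite st /K; lia.
have h2 : `|height_sum d i| <= (size b - k.+1)%N%:Z * K.
  by rewrite -sd; apply: height_sum_abs_le; rewrite sd /K; lia.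
have -> : (size b)%:Z * K = k%:Z * K + K + (size b - k.+1)%N%:Z * K.
  have -> : (size b)%:Z = k%:Z + 1 + (size b - k.+1)%N%:Z by lia.
  by rewrite !mulrDl mul1r.
apply: le_trans (ler_normD _ _) (lerD _ h2).
by apply: le_trans (ler_normD _ _) (lerD h1 _); rewrite /K; lia.
Qed.

(** * The bump as a walk *)

Lemma functional_comparable (S : Type) (st : relation S) x y z :
  (forall a b c, st a b -> st a c -> b = c) ->
  clos_refl_trans_1n S st x y -> clos_refl_trans_1n S st x z ->
  clos_refl_trans_1n S st y z \/ clos_refl_trans_1n S st z y.
Proof.
move=> F; elim=> [a|a b c ab bc IH]; first by left.
move=> az; case: az IH => [_|d e ad de IH].
  by right; apply: Relation_Operators.rt1n_trans ab bc.
by apply: IH; rewrite (F _ _ _ ab ad).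
Qed.

Lemma maximal_exists (S : Type) (st : relation S) (I : S -> Prop) (f : S -> int) (M : int) x :
  (forall a b, I a -> st a b -> I b /\ f b < f a) -> (forall a, I a -> - M <= f a) -> I x ->
  exists y, [/\ clos_refl_trans_1n S st x y, I y & forall z, ~ st y z].
Proof.
move=> dec bnd; have [n] : exists n : nat, f x + M <= n%:Z by exists `|(f x + M)%R|%N; lia.
elim: n x => [|n IH] x hn Ix.
  exists x; split => //; first by constructor.
  by move=> z /(dec _ _ Ix)[/bnd]; lia.
have [[z xz]|nz] := pselect (exists z, st x z).
  have [Iz lt] := dec _ _ Ix xz.
  have [|y [zy Iy hy]] := IH z _ Iz; first by lia.
  by exists y; split => //; apply: Relation_Operators.rt1n_trans xz zy.
by exists x; split => //; [constructor | move=> z xz; apply: nz; exists z].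
Qed.

Lemma clos_rt1n_transp (S : Type) (st : relation S) x y :
  clos_refl_trans_1n S (transp S st) x y -> clos_refl_trans_1n S st y x.
Proof.
elim=> [a|a b c ba _ cb]; first by constructor.
apply/clos_rt_rt1n/(rt_trans _ _ _ b); first exact: clos_rt1n_rt.
exact: rt_step.
Qed.

Lemma transp_clos_rt1n (S : Type) (st : relation S) x y :
  clos_refl_trans_1n S st x y -> clos_refl_trans_1n S (transp S st) y x.
Proof. by move=> h; apply: clos_rt1n_transp. Qed.

Lemma cross_sym b k r x y : cross b k r x y -> cross b k r y x.
Proof. by case=> kb rk h; split => //; apply/or_comm. Qed.

Lemma cross_labels b k r x y z i : cross b k r x y -> cross b k r z i ->
  (x = z /\ y = i) \/ (x = i /\ y = z).
Proof.
move=> /crossP[_ _ H] /crossP[_ _ H'].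
by case: H => -[hx hy]; case: H' => -[hz hi']; move: hz hi'; rewrite -hx -hy;
  move=> /prod_inj -> /prod_inj ->; auto.
Qed.

Lemma push_inj v i b b' k rho : active lo v i b k rho -> active lo v i b' k rho ->
  push (-1) b k rho = push (-1) b' k rho -> b = b'.
Proof.
move=> [kb rk _ _ _] [kb' rk' _ _ _] E.
have <- : push 1 (push (-1) b k rho) k (rho - 1) = b by apply: push_push; rewrite ?subrK.
by rewrite E; apply: push_push; rewrite ?subrK.
Qed.

Definition state := (seq nat * nat * int)%type.

Definition lower (v : int -> int) (i : int) (x : state) : Prop :=
  active lo v i x.1.1 x.1.2 x.2.

Definition pushed (x : state) : seq nat := push (-1) x.1.1 x.1.2 x.2.

(** One round of the bump. A state records the word before its push; the other column is only
    required to be active, since its existence, uniqueness and crossing wires follow from the flip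
    lemmas. *)
Definition step (v : int -> int) (i : int) : relation state := fun x y =>
  [/\ lower v i x, lower v i y, y.1.1 = pushed x, ~ reduced (pushed x) & y.1.2 <> x.1.2].

Lemma step_functional v i x y z : step v i x y -> step v i x z -> y = z.
Proof.
case: x y z => [[b k] rho] [[c l] sigma] [[c' l'] sigma'] [/= A B E _ n] [/= _ B' E' _ n'].
rewrite /lower /= in A B B'; subst c c'.
by have [-> ->] := active_flip_inj lo_inj (push_down A) B B' n n'.
Qed.

(** In the word of [z] the column just pushed is the only other deletable one, and the push can be
    undone. *)
Lemma step_injective v i x y z : step v i x z -> step v i y z -> x = y.
Proof.
case: x y z => [[b k] rho] [[b' k'] rho'] [[c l] sigma] [/= A B E _ n] [/= A' _ E' _ n'].
rewrite /lower /pushed /= in A A' B E E'.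
have H := push_down A; have H' := push_down A'; rewrite -E in H; rewrite -E' in H'.
have [] := active_flip_inj hi_inj B H H' (nesym n) (nesym n').
move=> ek er; have {}er : rho = rho' by apply: (addIr (-1)).
by subst k' rho'; rewrite (push_inj A A' _ : b = b') // -E E'.
Qed.

Lemma step_dec v i x y : step v i x y ->
  size y.1.1 = size x.1.1 /\ potential i y.1.1 y.1.2 < potential i x.1.1 x.1.2.
Proof.
case: x y => [[b k] rho] [[c l] sigma] [/= A B E nred n].
rewrite /lower /pushed /= in A B E nred *.
have kb : (k < size b)%N by case: A.
rewrite -(potential_push (-1) i rho kb) -(size_push (-1) rho kb) E; split=> //.
by rewrite E in B; apply: potential_flip (push_down A) B n.
Qed.

Lemma lower_no_succ v i x : lower v i x -> (forall y, ~ step v i x y) -> reduced (pushed x).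
Proof.
move=> A h; apply: contrapT => nred.
have [l [rho [z [B n _ _]]]] := flip_down (push_down A) nred.
by apply: (h (pushed x, l, rho)); split.
Qed.

(** If the word is not reduced, flipping up and then pushing up builds a predecessor. *)
Lemma lower_no_pred v i x : lower v i x -> (forall y, ~ step v i y x) -> reduced x.1.1.
Proof.
case: x => [[b k] rho] A h; apply: contrapT => /= nred; rewrite /lower /= in A.
have [l [rho' [B n]]] := flip_up A nred.
have kb : (l < size b)%N by case: B.
have E : pushed (push 1 b l rho', l, rho' + 1) = b.
  by apply: push_push => //; rewrite addrK; case: B.
apply: (h (push 1 b l rho', l, rho' + 1)); split; rewrite ?E //.
  exact: push_up.
exact: nesym.
Qed.

(** Steps preserve the length of the word, so one bound on the potential serves for the whole
    walk. *)
Lemma step_down v i x : lower v i x -> exists y,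
  [/\ clos_refl_trans_1n state (step v i) x y, lower v i y & reduced (pushed y)].
Proof.
move=> A; pose I y := lower v i y /\ size y.1.1 = size x.1.1.
have [||//|y [xy [B _] h]] := @maximal_exists state (step v i) I (fun y => potential i y.1.1 y.1.2)
  ((size x.1.1)%:Z * (`|i| + (size x.1.1)%:Z)) x.
- move=> a b [_ ea] st; have [eb lt] := step_dec st; split => //.
  by split; [case: st | rewrite eb].
- by move=> a [[ka _ _ _ _] <-]; have := potential_abs_le i ka; set B := _ * _; lia.
by exists y; split => //; apply: lower_no_succ h.
Qed.

Lemma step_up v i x : lower v i x -> exists y,
  [/\ clos_refl_trans_1n state (step v i) y x, lower v i y & reduced y.1.1].
Proof.
move=> A; pose I y := lower v i y /\ size y.1.1 = size x.1.1.
have [||//|y [xy [B _] h]] := @maximal_exists state (transp _ (step v i)) I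
  (fun y => - potential i y.1.1 y.1.2) ((size x.1.1)%:Z * (`|i| + (size x.1.1)%:Z)) x.
- move=> a b [_ ea] st; have [eb lt] := step_dec st; rewrite ltrN2; split => //.
  by split; [case: st | rewrite -eb].
- by move=> a [[ka _ _ _ _] <-]; have := potential_abs_le i ka; set B := _ * _; lia.
by exists y; split => //; [apply: clos_rt1n_transp | apply: lower_no_pred h].
Qed.

Lemma steps_maximal_inj v i x y z :
  clos_refl_trans_1n state (step v i) x y -> clos_refl_trans_1n state (step v i) x z ->
  reduced (pushed y) -> reduced (pushed z) -> y = z.
Proof.
move=> xy xz ry rz.
suff F a b : clos_refl_trans_1n state (step v i) a b -> reduced (pushed a) -> a = b.
  have [h|h] := functional_comparable (@step_functional v i) xy xz; first exact: F.
  by apply/esym/F.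
by case=> // c d [].
Qed.

Lemma steps_minimal_inj v i x y z :
  clos_refl_trans_1n state (step v i) x z -> clos_refl_trans_1n state (step v i) y z ->
  reduced x.1.1 -> reduced y.1.1 -> x = y.
Proof.
move=> xz0 yz0 rx ry; have xz := transp_clos_rt1n xz0; have yz := transp_clos_rt1n yz0.
suff F a b : clos_refl_trans_1n state (transp _ (step v i)) a b -> reduced a.1.1 -> a = b.
  have [||h] := functional_comparable _ xz yz; last 1 first.
  - by apply/esym/F.
  - by move=> a b c; apply: step_injective.
  by move=> h; apply: F.
by case=> // c d [_ _ ->].
Qed.

(** The premises of [bump_next] are supplied by [flip_down] (the crossings) and [deletion_unique]
    (the column). *)
Lemma step_bump_run v i x y c : step v i x y ->
  bump_run (-1) y.1.1 y.1.2 y.2 c -> bump_run (-1) x.1.1 x.1.2 x.2 c.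
Proof.
case: x y => [[b k] rho] [[c' l] sigma] [/= A B E nred n].
rewrite /lower /pushed /= in A B E nred *; subst c'; move=> run.
have [l0 [rho0 [z [B0 n0 X Y]]]] := flip_down (push_down A) nred.
have [el er] := active_flip_inj lo_inj (push_down A) B B0 n n0; subst l0 rho0.
have kb : (k < size b)%N by case: A.
apply: bump_next nred X _ Y run; split=> [|m [mk mb redm]].
  by case: B; rewrite size_push.
have [_ _ rk Pk _] := push_down A; have [lb _ rl Pl _] := B.
have := @deletion_unique _ k l m (nesym n) _ lb _ _ rk rl redm.
by rewrite size_push // => /(_ kb mb); rewrite Pk Pl => /(_ erefl)[].
Qed.

Lemma steps_bump_run v i x y : clos_refl_trans_1n state (step v i) x y ->
  reduced (pushed y) -> bump_run (-1) x.1.1 x.1.2 x.2 (pushed y).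
Proof.
elim=> [z|a b c ab _ IH] red; first exact: bump_stop.
exact: step_bump_run ab (IH red).
Qed.

(** Conversely the data of [bump_next] are forced: the column by [deletion_unique], and the row
    because two given wires cross in only one row of a column. *)
Lemma bump_run_steps v i b k rho c : bump_run (-1) b k rho c -> lower v i (b, k, rho) ->
  exists y, [/\ clos_refl_trans_1n state (step v i) (b, k, rho) y, reduced (pushed y)
    & c = pushed y].
Proof.
elim=> {b k rho c} [b k rho red A|b k rho l rho' x y c nred X [[lk lb redl] _] Y run IH A].
  by exists (b, k, rho); split => //; constructor.
have [l0 [rho0 [z [B n X0 Y0]]]] := flip_down (push_down A) nred.
have kb : (k < size b)%N by case: A.
have [_ _ rk Pk _] := push_down A; have [l0b _ rl0 Pl0 _] := B.
have el : l = l0.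
  have := @deletion_unique _ k l0 l (nesym n) _ l0b _ _ rk rl0 redl.
  by rewrite size_push // => /(_ kb lb); rewrite Pk Pl0 => /(_ erefl)[].
subst l0; have er : rho' = rho0.
  apply: cross_row_inj Y0.
  have [[ex ey]|[ex ey]] := cross_labels X X0; subst x y => //.
  exact: cross_sym.
subst rho0; have [d [steps red E]] := IH B.
by exists d; split => //; apply: Relation_Operators.rt1n_trans steps; split.
Qed.

(** * Length and finiteness *)

Lemma ell_le u c : P c = P u -> (ell (P u) <= size c)%N.
Proof. by case: (ellP u) => _; apply. Qed.

Lemma reduced_exists u : exists2 c, P c = P u & reduced c.
Proof. by have [[c hc sc] _] := ellP u; exists c => //; split; rewrite ?hc. Qed.

Lemma prod_shorten u x y : x <> 0 -> y <> 0 -> x < y -> P u y < P u x ->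
  exists2 c, P c = P u \o t x y & (size c).+1 = size u.
Proof.
move=> x0 y0 xy /(crossing_exists x0 y0 xy)[u1 [a [u2 [rho [-> ra hx hy]]]]].
exists (u1 ++ u2); first exact: prod_uncrossing hx hy x0 y0.
by rewrite !size_cat /= addnS.
Qed.

Lemma t_fix x y m : m <> x -> m <> y -> m <> - x -> m <> - y -> t x y m = m.
Proof. rewrite /t; cases; lia. Qed.

Lemma t_comp x m y : 0 < x -> x < m -> m < y -> t x m \o t m y \o t x m = t x y.
Proof.
move=> x0 xm my; have mI := can_inj (@t_involutive x m ltac:(lia) ltac:(lia)).
rewrite (t_conj _ _ mI); last by move=> z; apply: t_odd; lia.
rewrite t_r t_fix; [|lia..]; apply/funext => z /=; rewrite t_involutive //; lia.
Qed.

(* Used contrapositively: a transposition that jumps over an intermediate value is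
   not a cover. *)
Lemma prod_shorten3 u x m y : 0 < x -> x < m -> m < y -> P u y < P u m -> P u m < P u x ->
  exists2 c, P c = P u \o t x y & (size c + 3 = size u)%N.
Proof.
move=> x0 xm my ym mx.
have fy : t x m y = y by apply: t_fix; lia.
have fx : t m y x = x by apply: t_fix; lia.
(* The three factors of [t_comp] are applied in turn, each to an inversion of the current
   product. *)
have [||||c1 e1 s1] := @prod_shorten u x m => //; [lia..|].
have [||||c2 e2 s2] := @prod_shorten c1 m y => //; [lia..|by rewrite e1 /= t_r fy (lt_trans ym)|].
have [||||c3 e3 s3] := @prod_shorten c2 x m => //; [lia..| |].
  by rewrite e2 e1 /= t_l fx fy t_l.
exists c3; last by lia.
by rewrite e3 e2 e1 -(t_comp x0 xm my).
Qed.

(* [t x (x + n + 1)] is conjugate to [t (x + 1) (x + n + 1)] by [s x], and multiplying by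
   [s x] first shortens the word. *)
Lemma prod_lengthen n (x : nat) u : (0 < x)%N ->
  (forall j : nat, (0 < j <= n)%N -> P u (x + j)%N < P u x) ->
  exists2 c, P c = P u \o t x (x + n.+1)%N & (size c <= (size u).+1)%N.
Proof.
have sx (z : nat) : (0 < z)%N -> s z = t z z.+1.
  by case: z => // z _ /=; congr t; lia.
elim: n x u => [|n IH] x u x0 H.
  by exists (u ++ [:: x]); rewrite ?prod_cat ?size_cat /= ?sx ?addn1.
have lt : P u x.+1 < P u x by rewrite -addn1; apply: H.
have [||||u1 e1 s1] := @prod_shorten u x x.+1 => //; [lia..|].
have [//|j hj|c e sc] := IH x.+1 u1.
  rewrite e1 /= t_r t_fix; [|lia..]; rewrite addSnnS; apply: H; lia.
exists (c ++ [:: x]); last by rewrite size_cat /=; lia.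
rewrite prod_cat e e1 /= sx //.
have I := can_inj (@t_involutive x x.+1 ltac:(lia) ltac:(lia)).
have O z : t x x.+1 (- z) = - t x x.+1 z by apply: t_odd; lia.
have := t_conj x.+1 (x.+1 + n.+1)%N I O; rewrite t_r t_fix; [|lia..] => C.
apply/funext => z /=; congr (P u _); have /= -> := congr1 (fun f => f (t x x.+1 z)) C.
by rewrite t_involutive ?addSnnS //; lia.
Qed.

(** The wire descends from [n] to [j] one height at a time, skipping 0; [rho] below is the row whose
    lower height is [j]. *)
Lemma prod_to (n : nat) (j : int) : j <> 0 -> `|j| <= n%:Z ->
  exists u, P u n = j /\ forall m, n%:Z < m -> P u m = m.
Proof.
have [d] : exists d : nat, (`|(n%:Z - j)%R| <= d)%N by exists `|(n%:Z - j)%R|%N.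
elim: d j => [|d IH] j hd j0 jn; first by exists [::]; split => //=; lia.
have [->|jn'] := eqVneq j n%:Z; first by exists [::].
pose rho := if 0 < j then j else j + 1.
have el : lo rho = j by rewrite loE /rho; cases; lia.
have eh : hi rho = if j == -1 then 1 else j + 1 by rewrite hiE /rho; cases; lia.
have [|||u [hu fu]] := IH (hi rho); [rewrite eh; cases; lia.. |].
exists (`|rho|%N :: u); rewrite /= hu s_hi; last exact: is_row_abs.
split => // m nm; rewrite /= fu // (sE (is_row_abs rho)).
by move: eh; case: ifP => e eh; apply: t_fix; rewrite ?el ?eh; lia.
Qed.

Lemma prod_bij u : bijective (P u).
Proof. exact: Bijective (prod_revK u) (prod_Krev u). Qed.

(** Induction on the bound beyond which [w] is the identity: composing with the word that sends
    [n + 1] to its preimage under [w] makes [n + 1] fixed. *)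
Lemma Binf_prod w : Binf w -> exists u, P u = w.
Proof.
move=> [bw ow [n0 hn0]]; have [n hn] : exists n : nat, forall m, n%:Z < m -> w m = m.
  by exists `|n0|%N => m hm; apply: hn0; lia.
elim: n w bw ow hn {n0 hn0} => [|n IH] w bw ow hn.
  exists [::]; apply/funext => m /=; have [m0|m0|->] := ltgtP m 0.
  - by have := hn (- m); rewrite ow; lia.
  - by rewrite hn.
  - by have := ow 0; rewrite oppr0; move: (w 0) => z; lia.
have [g wg gw] := bw; pose j := g n.+1.
have wj : w j = n.+1 by rewrite /j gw.
have w0 : w 0 = 0 by have := ow 0; rewrite oppr0; move: (w 0) => z; lia.
have j0 : j <> 0 by move=> j0; move: wj; rewrite j0 w0.
have jn : `|j| <= n.+1%:Z.
  by have := hn j; have := hn (- j); rewrite ow wj; lia.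
have [u [hu fu]] := prod_to j0 jn.
have [|||c hc] := IH (w \o P u).
- exact: bij_comp bw (prod_bij u).
- by move=> m /=; rewrite prod_odd ow.
- move=> m hm /=; have [lt|gt|<-] := ltgtP n.+1%:Z m; [|lia|by rewrite hu].
  by rewrite fu // hn.
by exists (c ++ rev u); rewrite prod_cat hc; apply/funext => m /=; rewrite prod_Krev.
Qed.

(** The last letter [x] of a reduced word inverts [x] and [x + 1], so it cannot exceed [n]; removing
    it leaves finitely many words by induction. *)
Lemma finite_reduced_words p w : (exists n : nat, forall m, n%:Z < m -> w m = m) ->
  finite_set [set a | [/\ reduced a, P a = w & size a = p]].
Proof.
elim: p w => [|p IH] w [n hn].
  by apply: sub_finite_set (finite_set1 [::]) => a [_ _ /size0nil].
apply: (@sub_finite_set _ _ (\bigcup_(x in [set x | (x < n.+1)%N])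
   (rcons^~ x @` [set a | [/\ reduced a, P a = w \o s x & size a = p]]))).
  move=> a [red ea]; case/lastP: a red ea => // a x red ea; rewrite size_rcons => -[sa].
  rewrite -cats1 in red ea; exists x => /=.
    case: (ltnP x n.+1) => // nx; have rx : is_row x x by left.
    have [] := @reduced_crossing a x [::] x (lo x) (hi x) red rx erefl erefl.
    have el : lo x = x by rewrite loE; cases; lia.
    have eh : hi x = x.+1 by rewrite hiE; cases; lia.
    by rewrite ea el eh => _; rewrite !hn; lia.
  exists a => //; split => //; first exact: reduced_catl red.
  by rewrite -ea prod_cat; apply/funext => m /=; rewrite s_involutive.
apply: bigcup_finite; first exact: finite_II.
move=> x _; apply/finite_image/IH; exists (n + x.+1)%N => m hm /=.
by rewrite hn; case: x hm => [|x] hm /=; rewrite t_fix; lia.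
Qed.

Lemma finite_R w : Binf w -> finite_set (R w).
Proof.
move=> [_ _ [n hn]]; apply: (sub_finite_set _ (@finite_reduced_words (ell w) w _)).
  by move=> a [ha sa]; split; rewrite // /reduced ha.
by exists `|n|%N => m hm; apply: hn; lia.
Qed.

Lemma size_reduced a : reduced a -> size a = ell (P a). Proof. by case. Qed.

(** A reduced output determines its active column, the only one whose removal gives [v], and there
    the push can be undone. *)
Lemma pushed_inj v i x y : lower v i x -> lower v i y -> reduced (pushed x) ->
  pushed x = pushed y -> x = y.
Proof.
case: x y => [[b k] rho] [[b' k'] rho'] A B red E.
have B' := push_down B; rewrite -[push _ _ _ _]/(pushed (b', k', rho')) -E in B'.
have [ek er] := active_reduced_inj hi_inj red (push_down A) B'.
have {}er : rho = rho' by apply: (addIr (-1)).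
by rewrite /= in ek; subst k' rho'; rewrite (push_inj A B E : b = b').
Qed.

(** * The transition *)

Section Transition.
Variables (w : int -> int) (r q : int).
Hypotheses (wB : Binf w) (rq : lex_largest_inversion w r q).
Let v := w \o t r q.

Let wI : injective w.
Proof. by case: wB => /bij_inj. Qed.

Let r0 : 0 < r. Proof. by case: rq => -[]. Qed.
Let ltrq : r < q. Proof. by case: rq => -[]. Qed.
Let ltw : w q < w r. Proof. by case: rq => -[]. Qed.

(** An inversion starting after [r] would be lexicographically larger than [(r, q)]. *)
Let w_incr m m' : r < m -> m < m' -> w m < w m'.
Proof.
move=> rm mm; case: (ltgtP (w m) (w m')) => // [lt|/wI]; last by lia.
have [_ /(_ m m')] := rq; rewrite /inversion => H.
by have [|lt'|[]] := H; [split; lia|lia|lia].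
Qed.

Let w_gt y : q < y -> w r < w y.
Proof.
move=> qy; case: (ltgtP (w r) (w y)) => // [lt|/wI]; last by have := ltrq; lia.
have [_ /(_ r y)] := rq; rewrite /inversion => H.
by have [|lt'|[]] := H; [split; have := r0; have := ltrq; lia|lia|lia].
Qed.

Let vr : v r = w q. Proof. by rewrite /v /= t_l. Qed.
Let vq : v q = w r. Proof. by rewrite /v /= t_r. Qed.
Let vy y : 0 < y -> y <> r -> y <> q -> v y = w y.
Proof. by move=> y0 yr yq; rewrite /v /= t_fix //; have := r0; have := ltrq; lia. Qed.

Let vt : v \o t r q = w.
Proof. by apply/funext => m; rewrite /v /= t_involutive //; have := r0; have := ltrq; lia. Qed.

Lemma reduced_word_v : exists2 d, P d = v & reduced d.
Proof.
have r0' := r0; have rq' := ltrq; have [b hb] := Binf_prod wB.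
have [||||c hc _] := @prod_shorten b r q; rewrite ?hb //; [lia|lia|].
by have [d hd rd] := reduced_exists c; exists d; rewrite // hd hc hb.
Qed.

(** Undoing the inversion [(r, q)] shortens [w], which gives one inequality; [prod_lengthen] applied
    to [v] gives the other. *)
Lemma ell_transition : ell w = (ell v).+1.
Proof.
have r0' := r0; have rq' := ltrq.
have [b hb] := Binf_prod wB; have [a ha ra] := reduced_exists b; rewrite hb in ha.
have [||||c hc sc] := @prod_shorten a r q; rewrite ?ha //; [lia|lia|].
have [d hd rd] := reduced_exists c; rewrite hc ha -/v in hd.
(* With this [n] the transposition is [t r q]. Strictly between [r] and [q] the values of [v] are
   those of [w], which lie below [w q = v r]. *)
have [|j hj|e he se] := @prod_lengthen `|(q - r - 1)%R|%N `|r|%N d; first by lia.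
  rewrite hd (_ : `|r|%N = r :> int); last by lia.
  by rewrite vr vy; [apply: w_incr; lia|lia|lia|lia].
have lev : (ell v <= size c)%N by rewrite -hd; apply: ell_le; rewrite hd hc ha.
rewrite hd (_ : `|r|%N = r :> int) in he; last by lia.
rewrite (_ : (_ + _)%N = q :> int) ?vt in he; last by lia.
have := size_reduced ra; have := size_reduced rd; rewrite ha hd => sd sa.
have : (ell w <= size e)%N by rewrite -he; apply: ell_le.
lia.
Qed.

Lemma start_lower a k rho : R w a -> cross a k rho r q -> lower v r (a, k, rho).
Proof.
have r0' := r0; have rq' := ltrq.
move=> [ha sa] /crossP[ka rk H]; have E := split_word ka.
have red : reduced (take k a ++ nth 0%N a k :: drop k.+1 a) by rewrite -E /reduced ha.
have [hr hq] : P (drop k.+1 a) r = lo rho /\ P (drop k.+1 a) q = hi rho.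
  by case: H => -[h1 h2] //; have [] := reduced_crossing red rk h1 h2; lia.
have Pv : P (delete a k) = v.
  by rewrite /delete (prod_uncrossing _ rk hr hq) -?E ?ha //; lia.
split=> //; apply/reducedP => c; rewrite Pv => hc.
by have := ell_le (erefl (P c)); rewrite hc size_delete // sa ell_transition.
Qed.

Lemma cross_exists a : R w a -> exists k rho, cross a k rho r q.
Proof.
have r0' := r0; have rq' := ltrq; move=> [ha sa].
have [||||u1 [c [u2 [rho [E rc hr hq]]]]] := @crossing_exists a r q; rewrite ?ha //; [lia|lia|].
exists (size u1), rho; apply/crossP; rewrite (nth_size_cat E) // (drop_size_cat1 E) //.
by split => //; [rewrite E size_cat /=; lia | left].
Qed.

Lemma active_ell h x : active h v r x.1.1 x.1.2 x.2 -> size x.1.1 = ell w.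
Proof.
move=> [ka _ [_ sd] Pv _]; have := size_delete ka.
by rewrite sd Pv ell_transition; lia.
Qed.

(** The word represents [v t_rz] with [r < z] and [v r < v z]. If [z < q], then [w z < w q = v r], a
    contradiction. If [q < z], then [q] lies between and [prod_shorten3] makes [v] too short. So
    [z = q]. *)
Lemma lower_start x : lower v r x -> reduced x.1.1 ->
  R w x.1.1 /\ cross x.1.1 x.1.2 x.2 r q.
Proof.
have r0' := r0; have rq' := ltrq; have ltw' := ltw.
move=> A red; have sa := active_ell A; case: x A red sa => [[a k] rho] A /= red sa.
have [/= ka rk redk Pv hr] := A; have E := split_word ka.
set z := P (rev (drop k.+1 a)) (hi rho).
have hz : P (drop k.+1 a) z = hi rho by rewrite prod_Krev.
have z0 := label_neq0 hz (@hi_neq0 _).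
have red' : reduced (take k a ++ nth 0%N a k :: drop k.+1 a) by rewrite -E.
have [rz] := reduced_crossing red' rk hr hz; rewrite -E => inv.
have Pa : P a = v \o t r z by rewrite {1}E (prod_crossing _ rk hr hz) -Pv.
have Pva : P a \o t r z = v by apply/funext => m; rewrite Pa /= t_involutive //; lia.
suff zq : z = q.
  split; last by rewrite -zq; apply/crossP; split => //; left.
  by split => //; rewrite Pa zq.
move: inv; rewrite Pa /= t_l t_r vr => inv.
case: (ltgtP z q) => // [zq|qz].
  by have := w_incr rz zq; rewrite vy in inv; lia.
have Paq : P a q = w r by rewrite Pa /= t_fix ?vq //; lia.
have [|||||c hc sc] := @prod_shorten3 a r q z => //.
- by rewrite Paq Pa /= t_r vr.
- by rewrite Paq Pa /= t_l vy; [apply: w_gt|lia..].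
by have := ell_le (erefl (P c)); rewrite hc Pva; have := ell_transition; lia.
Qed.

Lemma upper_end c k sigma : active hi v r c k sigma -> reduced c ->
  exists2 w', T w r q w' & R w' c.
Proof.
move=> A red; have /= sa := @active_ell hi (c, k, sigma) A.
have [kc rk redk Pv hr] := A; have E := split_word kc.
set z := P (rev (drop k.+1 c)) (lo sigma).
have hz : P (drop k.+1 c) z = lo sigma by rewrite prod_Krev.
have z0 := label_neq0 hz (@lo_neq0 _).
have red' : reduced (take k c ++ nth 0%N c k :: drop k.+1 c) by rewrite -E.
have [zr _] := reduced_crossing red' rk hz hr.
have Pc : P c = v \o t z r by rewrite {1}E (prod_crossing _ rk hz hr) -Pv.
exists (P c) => //; exists z; split => //.
by rewrite -(size_reduced red).
Qed.

(** If [v z < v r], the word [c] crosses [z] and [r], and erasing that column leaves a word of [v]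
    of minimal length. If [v r < v z], then [w'] would be shorter than [v], against the definition
    of [T]. *)
Lemma end_upper w' c : T w r q w' -> R w' c -> exists k sigma, active hi v r c k sigma.
Proof.
have r0' := r0; move=> [z [zr z0 ew' lw']] [Pc sc]; rewrite -/v in ew'.
have r0n : r <> 0 by lia.
have vE : v = P c \o t z r.
  by apply/funext => m; rewrite Pc ew' /= t_involutive.
have vI : injective v by apply: inj_comp wI (can_inj (t_involutive _ _)); have := ltrq; lia.
case: (ltgtP (v z) (v r)) => [lt|gt|/vI]; last by lia.
- have [||||u1 [d [u2 [rho [E rd hz hr]]]]] := @crossing_exists c z r => //.
    by rewrite Pc ew' /= t_l t_r.
  have D : delete c (size u1) = u1 ++ u2 by apply: delete_cat E _.
  have Pv : P (u1 ++ u2) = v by rewrite (prod_uncrossing _ rd hz hr) -?E.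
  exists (size u1), rho; split; rewrite ?D ?(nth_size_cat E) ?(drop_size_cat1 E) //.
    by rewrite E size_cat /=; lia.
  apply/reducedP => e; rewrite Pv => he.
  have := ell_le (erefl (P e)); rewrite he.
  have := congr1 size E; rewrite sc lw' ell_transition !size_cat /=; lia.
have [d hd rd] := reduced_word_v.
have [||||e he se] := @prod_shorten d z r => //; first by rewrite hd.
have := ell_le (erefl (P e)); rewrite he hd -ew' lw' ell_transition.
by have := size_reduced rd; rewrite hd; lia.
Qed.

Lemma bump_graphP a b : R w a -> bump_graph (-1) r q a b <->
  exists x y, [/\ x.1.1 = a, lower v r x,
    clos_refl_trans_1n state (step v r) x y, reduced (pushed y) & b = pushed y].
Proof.
have r0' := r0; have rq' := ltrq; move=> Ra; have [Pa sa] := Ra; split.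
  move=> [_ [_ _ [k [rho [X run]]]]]; have A := start_lower Ra X.
  by have [y [xy red ->]] := bump_run_steps run A; exists (a, k, rho), y.
move=> [[[a' k] rho] [y [/= -> A xy red ->]]]; split; first by split; lia.
split; rewrite ?Pa -/v ?ell_transition //; first by rewrite /reduced Pa.
exists k, rho; split; last exact: steps_bump_run xy red.
by have [|//] := lower_start A; rewrite /= /reduced Pa.
Qed.

Lemma reduced_R a : R w a -> reduced a.
Proof. by move=> Ra; have [Pa _] := Ra; rewrite /reduced Pa. Qed.

Lemma lower_exists a : R w a -> exists2 x, x.1.1 = a & lower v r x.
Proof.
move=> Ra; have [k [rho X]] := cross_exists Ra.
by exists (a, k, rho) => //; apply: start_lower Ra X.
Qed.

Lemma bump_graph_exists a : R w a -> exists b, bump_graph (-1) r q a b.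
Proof.
move=> Ra; have [x xa A] := lower_exists Ra; have [y [xy _ red]] := step_down A.
by exists (pushed y); apply/bump_graphP => //; exists x, y.
Qed.

Lemma lower_reduced_inj x y : lower v r x -> lower v r y -> reduced x.1.1 -> x.1.1 = y.1.1 -> x = y.
Proof.
case: x y => [[a k] rho] [[b l] sigma] /= A B red E; subst b.
by have [/= -> ->] := active_reduced_inj lo_inj red A B.
Qed.

Lemma bump_graph_unique a b c : R w a ->
  bump_graph (-1) r q a b -> bump_graph (-1) r q a c -> b = c.
Proof.
move=> Ra /(bump_graphP _ Ra)[x [y [xa A xy ry ->]]] /(bump_graphP _ Ra)[x' [z [xa' A' xz rz ->]]].
have E : x = x' by apply: lower_reduced_inj => //; rewrite xa ?xa' //; apply: reduced_R.
by subst x'; rewrite (steps_maximal_inj xy xz ry rz).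
Qed.

Lemma little_bump_graph a b : R w a -> bump_graph (-1) r q a b -> little_bump (-1) r q a = b.
Proof.
by move=> Ra G; apply: xget_unique => // c Gc; apply: bump_graph_unique Ra Gc G.
Qed.

Lemma steps_lower x y : lower v r x -> clos_refl_trans_1n state (step v r) x y -> lower v r y.
Proof. by move=> + xy; elim: xy => // a b c [_ B _ _ _] _ IH _; apply: IH. Qed.

(** Injectivity retraces a walk from its output: [pushed_inj] recovers the last state and
    [steps_minimal_inj] the first. For surjectivity the target is pushed up in its active column and
    the walk is followed backwards to a reduced word, which [lower_start] places in [R w]. *)
Lemma little_bump_bij :
  set_bij (R w) (\bigcup_(w' in T w r q) R w') (little_bump (-1) r q).
Proof.
split.
- move=> a Ra; have [b G] := bump_graph_exists Ra; rewrite (little_bump_graph Ra G).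
  have [x [y [xa A xy red ->]]] := (bump_graphP _ Ra).1 G.
  by have [w' Tw' Rw'] := upper_end (push_down (steps_lower A xy)) red; exists w'.
- move=> a a' /set_mem Ra /set_mem Ra'.
  have [b G] := bump_graph_exists Ra; have [b' G'] := bump_graph_exists Ra'.
  rewrite (little_bump_graph Ra G) (little_bump_graph Ra' G') => E; subst b'.
  have [x [y [xa A xy red eb]]] := (bump_graphP _ Ra).1 G.
  have [x' [y' [xa' A' xy' red' eb']]] := (bump_graphP _ Ra').1 G'.
  suff E : y = y'.
    subst y'; rewrite -xa -xa'; congr (_.1.1).
    by apply: steps_minimal_inj xy xy' _ _; rewrite ?xa ?xa'; apply: reduced_R.
  apply: pushed_inj (steps_lower A xy) (steps_lower A' xy') red _.
  by rewrite -eb.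
- move=> b [w' Tw' Rb]; have [k [sigma B]] := end_upper Tw' Rb.
  have redb : reduced b by have [Pb _] := Rb; rewrite /reduced Pb.
  have E : pushed (push 1 b k sigma, k, sigma + 1) = b.
    by case: B => kb rk _ _ _; apply: push_push; rewrite ?addrK.
  have [x [xy A redx]] := step_up (push_up B : lower v r (push 1 b k sigma, k, sigma + 1)).
  have [Rx _] := lower_start A redx; exists x.1.1 => //.
  apply: little_bump_graph => //; apply/bump_graphP => //.
  by exists x, (push 1 b k sigma, k, sigma + 1); split; rewrite ?E.
Qed.

(** The length of [w'] is positive, so it is not the default 0 of [ell], and [w'] is the product of
    some word. *)
Lemma T_word w' : T w r q w' -> exists c, R w' c.
Proof.
move=> [z [_ _ _]]; rewrite ell_transition /R /ell; case: xgetP => [p -> [[c hc sc] _] _|//].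
by exists c.
Qed.

Lemma finite_T : finite_set (T w r q).
Proof.
apply: (@sub_finite_set _ _ (P @` (\bigcup_(w' in T w r q) R w'))).
  move=> w' Tw'.
  by have [c Rc] := T_word Tw'; exists c; [exists w' | case: Rc].
case: little_bump_bij => _ _ /sub_finite_set sur.
by apply/finite_image/sur/finite_image/finite_R.
Qed.
End Transition.

(** * Counting reduced words *)

Lemma card_fset_set_bij (I J : choiceType) (A : set I) (B : set J) (f : I -> J) :
  finite_set A -> set_bij A B f -> #|` fset_set A|%fset = #|` fset_set B|%fset.
Proof.
move=> fA [fun_f inj_f sur_f]; have -> : B = f @` A.
  by apply/seteqP; split => // x [a Aa <-]; apply: fun_f.
rewrite fset_set_image // card_in_imfset // => x y /=.
by rewrite !in_fset_set //; apply: inj_f.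
Qed.

Lemma card_fset_set_fibers (I J : choiceType) (A : set I) (B : set J) (f : I -> J) :
  finite_set A -> B = f @` A ->
  #|` fset_set A|%fset
  = (\big[addn/0%N]_(j \in B) #|` fset_set (A `&` f @^-1` [set j])|%fset)%N.
Proof.
move=> fA ->; rewrite fsbig_finite ?fset_set_image //; last exact: finite_image.
rewrite card_fset_sum1 (partition_big_imfset _ f) /=; apply: eq_bigr => j _.
rewrite big_fset_condE -card_fset_sum1; congr (#|` _|)%fset.
apply/fsetP => i; rewrite in_fset_set; last exact: finite_setIl.
apply/imfsetP/idP => [[x /= /andP[]]|/set_mem[Ai fi]].
  by rewrite in_fset_set // => /set_mem Ax /eqP fx ->; apply/mem_set.
by exists i => //=; apply/andP; rewrite in_fset_set // fi; split => //; apply/mem_set.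
Qed.

Theorem theorem1p1 (w : int -> int) (hw : Binf w) (hninc : ~ increasing w)
    (r q : int) (hrq : lex_largest_inversion w r q) :
  (forall a, R w a -> exists! b, bump_graph (-1) r q a b)
  /\ set_bij (R w) (\bigcup_(w' in T w r q) R w') (little_bump (-1) r q)
  /\ [/\ finite_set (R w), finite_set (T w r q),
         (forall w', T w r q w' -> finite_set (R w'))
       & #|` fset_set (R w)|%fset
         = (\big[addn/0%N]_(w' \in T w r q) #|` fset_set (R w')|%fset)%N].
Proof.
have bij := little_bump_bij hw hrq; have fR := finite_R hw.
have fU : finite_set (\bigcup_(w' in T w r q) R w').
  by case: bij => _ _ /sub_finite_set; apply; apply: finite_image.
have TR w' : T w r q w' -> exists c, R w' c.
  by move=> Tw'; apply: (T_word hw hrq Tw').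
split.
  move=> a Ra; have [b G] := bump_graph_exists hw hrq Ra.
  by exists b; split => // c; apply: (bump_graph_unique hw hrq Ra G).
split=> //; split => //; first exact: (finite_T hw hrq).
  by move=> w' Tw'; apply: sub_finite_set fU => c Rc; exists w'.
rewrite (card_fset_set_bij fR bij).
(* The union is counted along the fibres of [P]: the fibre over [w'] is [R w'], so the union is
   disjoint. *)
rewrite (@card_fset_set_fibers _ _ _ (T w r q) P fU); last first.
  apply/seteqP; split=> [w' Tw'|_ [c [w' Tw' [ew _]] <-]]; last by rewrite ew.
  by have [c Rc] := TR w' Tw'; exists c; [exists w' | case: Rc].
apply: eq_fsbigr => w' /set_mem Tw'; congr (#|` fset_set _|)%fset.
apply/seteqP; split => [c [[u Tu [ec sc]] /= <-]|c Rc]; first by rewrite ec.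
by split; [exists w' | case: Rc].
Qed.
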